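(* Let $(X,p)$ be a partial metric space and let $a$ be a real constant such that $p(x,x)=a$ for all $x\in X$. Let $\{x_n\}$ be a sequence in $X$. If $c\in X$ is a statistical cluster point of $\{x_n\}$, then $st\text{-}LIM^{r}x_n\subset\overline{B^{p}_{r}}(c)$ for some $r>0$.
   Context: A partial metric on a nonempty set $X$ is a function $p:X\times X\to[0,\infty)$ such that for all $x,y,z\in X$: (p1) $0\le p(x,x)\le p(x,y)$; (p2) $x=y$ if and only if $p(x,x)=p(x,y)=p(y,y)$; (p3) $p(x,y)=p(y,x)$; (p4) $p(x,y)\le p(x,z)+p(z,y)-p(z,z)$. The pair $(X,p)$ is called a partial metric space. For $r>0$ and $x\in X$, the closed ball is $\overline{B^{p}_{r}}(x)=\{y\in X:p(x,y)\le p(x,x)+r\}$. For $B\subset\mathbb N$, the natural density is $d(B)=\lim_{n\to\infty}\frac{|\{k\in B:k\le n\}|}{n}$, if the limit exists. The condition $d(B)\ne 0$ means that it is not the case that $B$ has natural density $0$ (either the limit does not exist, or it exists and is nonzero). For a real number $r\ge 0$, a sequence $\{x_n\}$ in $X$ is $r$-statistically convergent to $x\in X$ if for every $\varepsilon>0$, $d(\{n\in\mathbb N:|p(x_n,x)-p(x,x)|\ge r+\varepsilon\})=0$. The $r$-st limit set $st\text{-}LIM^{r}x_n$ is the set of all $x\in X$ such that $\{x_n\}$ is $r$-statistically convergent to $x$. A point $c\in X$ is a statistical cluster point of $\{x_n\}$ if for every $\varepsilon>0$, $d(\{n\in\mathbb N:|p(x_n,c)-p(c,c)|<\varepsilon\})\ne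 0$. *)

(* Defs.v *)
From HB Require Import structures.
From mathcomp Require Import all_boot all_order all_algebra.
From mathcomp Require Import all_classical all_reals all_analysis.
Set Implicit Arguments.
Unset Strict Implicit.
Unset Printing Implicit Defensive.
Import Order.TTheory GRing.Theory Num.Theory.
Import numFieldNormedType.Exports.
Local Open Scope classical_set_scope.
Local Open Scope ring_scope.

Record is_partial_metric (R : realType) (X : Type) (p : X -> X -> R) : Prop :=
  IsPartialMetric {
    pm_nonempty : inhabited X ;
    pm_small_self : forall x y, 0 <= p x x <= p x y ;
    pm_sep : forall x y, x = y <-> (p x x = p x y /\ p x y = p y y) ;
    pm_sym : forall x y, p x y = p y x ;
    pm_triangle : forall x y z, p x y <= p x z + p z y - p z z
  }.

Definition pm_closed_ball (R : realType) (X : Type) (p : X -> X -> R)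
    (r : R) (x : X) : set X :=
  [set y | p x y <= p x x + r].

Definition initial_count (B : set nat) (n : nat) : nat :=
  #|[pred k : 'I_n.+1 | nat_of_ord k \in B]|.

(* Indices start at 0, and the term at n = 0 is 0 because 0^-1 = 0; neither
   choice affects the existence or the value of the limit. *)
Definition has_density (R : realType) (B : set nat) (d : R) : Prop :=
  ((initial_count B n)%:R / n%:R : R) @[n --> \oo] --> d.

Definition stat_convergent (R : realType) (X : Type) (p : X -> X -> R)
    (r : R) (u : nat -> X) (x : X) : Prop :=
  forall eps : R, 0 < eps ->
    has_density [set n | `|p (u n) x - p x x| >= r + eps] (0 : R).

Definition stLIM (R : realType) (X : Type) (p : X -> X -> R)
    (r : R) (u : nat -> X) : set X :=
  [set x | stat_convergent p r u x].

(* The negation of "density 0" also covers sets that have no density. *)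
Definition stat_cluster_point (R : realType) (X : Type) (p : X -> X -> R)
    (u : nat -> X) (c : X) : Prop :=
  forall eps : R, 0 < eps ->
    ~ has_density [set n | `|p (u n) c - p c c| < eps] (0 : R).

(* Main.v *)
(* If y were a limit with p c y > a + r, put eps = (p c y - a - r) / 2. By the
   triangle inequality through u n, every index n with |p (u n) c - a| < eps
   satisfies |p (u n) y - a| >= r + eps. The latter indices have density 0,
   hence so have the former, and c is not a statistical cluster point. This
   works for every r. *)
Require Import Defs.
From HB Require Import structures.
From mathcomp Require Import all_boot all_order all_algebra.
From mathcomp Require Import all_classical all_reals all_analysis.
From mathcomp Require Import lra.
Import Order.TTheory GRing.Theory Num.Theory.
Import numFieldNormedType.Exports.
Local Open Scope classical_set_scope.
Local Open Scope ring_scope.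

Lemma initial_count_subset (A B : set nat) (n : nat) :
  A `<=` B -> (initial_count A n <= initial_count B n)%N.
Proof.
move=> AB; apply/subset_leq_card/fintype.subsetP => k.
by rewrite !unfold_in => /set_mem /AB /mem_set.
Qed.

(** Squeeze: the ratios for [A] lie between 0 and those for [B], for every [n]. *)
Lemma has_density0_subset (R : realType) (A B : set nat) :
  A `<=` B -> has_density B (0 : R) -> has_density A (0 : R).
Proof.
move=> AB; apply: squeeze_cvgr; last exact: cvg_cst.
apply: nearW => n; rewrite divr_ge0 //=.
by rewrite ler_wpM2r ?invr_ge0 // ler_nat initial_count_subset.
Qed.

Lemma stLIM_subset_closed_ball (R : realType) (X : Type) (p : X -> X -> R)
    (a r : R) (u : nat -> X) (c : X) :
  is_partial_metric p -> (forall x, p x x = a) -> stat_cluster_point p u c ->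
  stLIM p r u `<=` pm_closed_ball p r c.
Proof.
move=> hp ha hc y yu; rewrite /pm_closed_ball /= ha leNgt; apply/negP => lt_y.
(* Thus [p c y = a + r + 2 * eps]: one [eps] pays for the distance from [u n] to [c], the other is
   the margin above [r]. *)
pose eps := (p c y - (a + r)) / 2.
have eps_gt0 : 0 < eps by rewrite /eps; lra.
apply: (hc eps eps_gt0); apply: has_density0_subset (yu eps eps_gt0) => n /=.
rewrite !ha ltr_norml => /andP[_ lt_c].
have := pm_triangle hp c y (u n); rewrite ha (pm_sym hp c (u n)) => tri.
(* Without the absolute value, [tri] and [lt_c] give [p (u n) y - a > r + eps]. *)
by apply: le_trans (ler_norm _); move: lt_c; rewrite /eps; lra.
Qed.

Theorem theorem2p9 (R : realType) (X : Type) (p : X -> X -> R)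
    (hp : is_partial_metric p) (a : R) (ha : forall x : X, p x x = a)
    (u : nat -> X) (c : X) (hc : stat_cluster_point p u c) :
  exists r : R, 0 < r /\ stLIM p r u `<=` pm_closed_ball p r c.
(* The radius 1 is an arbitrary positive choice. *)
Proof. by exists 1; split; [exact: ltr01|exact: stLIM_subset_closed_ball ha hc]. Qed.
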